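(* Let $\{P(t)\}_{t\ge 0}$, $P(t)=(p_{ij}(t))$, be a sequence of $N\times N$ row-stochastic matrices with positive diagonal entries such that $$p^+:=\inf_{t\ge 0}\Big[\min_{i,j:\,p_{ij}(t)>0}p_{ij}(t)\Big]>0.$$ For each $t\ge 0$ let $G(t)=(V,E(t))$ be the directed graph with $V=\{1,\dots,N\}$ and $(i,j)\in E(t)$ if and only if $p_{ij}(t)>0$. Suppose there exists $t_0\in\mathbb N$ such that for all $t\ge 0$ the union graph $$\bigcup_{t\le s<t+t_0}G(s):=\Big(V,\bigcup_{t\le s<t+t_0}E(s)\Big)$$ is strongly connected. Then $\{P(t)\}_{t\ge0}$ satisfies the following condition: $p^+>0$, and there exists $T\in\mathbb N$ such that $$P(t+T-1)P(t+T-2)\cdots P(t)>0\qquad\text{for all }t\ge 0.$$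
   Context: A nonnegative square matrix is row-stochastic if each of its rows sums to $1$. For a matrix $A$, $A>0$ means every entry is positive. A directed graph $(V,E)$, $E\subseteq V\times V$, is strongly connected if for any $(i,j)\in V\times V$ there is a finite sequence of vertices $i=i_0,i_1,\dots,i_n=j$ in $V$ with $(i_{l-1},i_l)\in E$ for $l=1,\dots,n$. *)

(* Defs.v *)
From HB Require Import structures.
From mathcomp Require Import all_boot all_order all_algebra.
From mathcomp Require Import all_classical all_reals ereal.
Set Implicit Arguments.
Unset Strict Implicit.
Unset Printing Implicit Defensive.
Import Order.TTheory GRing.Theory Num.Theory.
Local Open Scope ring_scope.

Definition row_stochastic (R : realType) (N : nat) (A : 'M[R]_N) : Prop :=
  (forall i j, 0 <= A i j) /\ (forall i, \sum_j A i j = 1).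

Definition mx_gt0 (R : realType) (N : nat) (A : 'M[R]_N) : Prop :=
  forall i j, 0 < A i j.

(* The minimum is taken in \bar R, where +oo is the neutral element of min, so
   that no default value interferes with it; when A has at least one positive
   entry it is the real number min_{A i j > 0} A i j. *)
Definition min_pos_entry (R : realType) (N : nat) (A : 'M[R]_N) : \bar R :=
  \big[Order.min/+oo%E]_(ij : 'I_N * 'I_N | 0 < A ij.1 ij.2) (A ij.1 ij.2)%:E.

Definition p_plus (R : realType) (N : nat) (P : nat -> 'M[R]_N) : \bar R :=
  ereal_inf (range (fun t => min_pos_entry (P t))).

Definition edges (R : realType) (N : nat) (A : 'M[R]_N) : {set 'I_N * 'I_N} :=
  finset (fun ij => 0 < A ij.1 ij.2).

Definition union_edges (R : realType) (N : nat) (P : nat -> 'M[R]_N)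
    (t t0 : nat) : {set 'I_N * 'I_N} :=
  (\bigcup_(t <= s < t + t0) edges (P s))%SET.

Definition strongly_connected (V : finType) (E : {set V * V}) : Prop :=
  forall i j : V, connect (fun x y => (x, y) \in E) i j.

(* P (t + T - 1) *m P (t + T - 2) *m ... *m P t, with T factors. *)
Definition backward_prod (R : realType) (N : nat) (P : nat -> 'M[R]_N)
    (t T : nat) : 'M[R]_N :=
  \big[mulmx/1%:M]_(k < T) P (t + T - 1 - k)%N.

(* Main.v *)
(* Fix t and j and let S_T be the set of i such that the (i, j) entry of
   P(t+T-1) ... P(t) is positive.  Positive diagonals make S_T nondecreasing
   in T, and j belongs to S_0.  As long as S_T is not all of V, strong
   connectivity of the union graph over [t+T, t+T+t0) provides an edge leading
   from outside S_T into S_T, so that S_(T+t0) is strictly larger than S_T.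
   Hence S_T is all of V once T >= N t0. *)
Require Import Defs.
From HB Require Import structures.
From mathcomp Require Import all_boot all_order all_algebra.
From mathcomp Require Import all_classical all_reals ereal.
Set Implicit Arguments.
Unset Strict Implicit.
Unset Printing Implicit Defensive.
Import Order.TTheory GRing.Theory Num.Theory.
Local Open Scope ring_scope.

(** Take [v] to be the first vertex of the path that lies in [S], and [u] its predecessor. *)
Lemma connect_boundary (V : finType) (e : rel V) (S : {set V}) (x y : V) :
  connect e x y -> x \notin S -> y \in S ->
  exists u v, [/\ e u v, u \notin S & v \in S].
Proof.
move=> /connectP[p]; elim: p x => [|z p IHp] x /=.
  by move=> _ -> /negP.
move=> /andP[exz pzp] y_last xS yS.
case: (boolP (z \in S)) => zS; first by exists x, z.
exact: IHp pzp y_last zS yS.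
Qed.

Section BackwardProd.
Variables (R : realType) (N : nat) (P : nat -> 'M[R]_N).

Lemma backward_prod0 (t : nat) : backward_prod P t 0 = 1%:M.
Proof. by rewrite /backward_prod big_ord0. Qed.

Lemma backward_prodS (t T : nat) :
  backward_prod P t T.+1 = P (t + T)%N *m backward_prod P t T.
Proof.
rewrite /backward_prod big_ord_recl; congr (P _ *m _).
  by rewrite subn0 addnS subn1.
apply: eq_bigr => k _; congr (P _).
by rewrite addnS subn1 /= /bump /= add1n -subnDA add1n.
Qed.

Hypothesis P_ge0 : forall t i j, 0 <= P t i j.

Lemma backward_prod_ge0 (t T : nat) (i j : 'I_N) :
  0 <= backward_prod P t T i j.
Proof.
elim: T i => [|T IHT] i; first by rewrite backward_prod0 mxE ler0n.
by rewrite backward_prodS mxE sumr_ge0 // => k _; rewrite mulr_ge0.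
Qed.

(** The set S_T, for the start time [t] and column [j]. *)
Definition pos_rows (t : nat) (j : 'I_N) (T : nat) : {set 'I_N} :=
  finset (fun i => 0 < backward_prod P t T i j).

(** In the sum giving the new entry, the term at [k] is positive and the others are nonnegative. *)
Lemma pos_rowsS (t : nat) (j : 'I_N) (T : nat) (i k : 'I_N) :
  0 < P (t + T)%N i k -> k \in pos_rows t j T -> i \in pos_rows t j T.+1.
Proof.
rewrite !inE backward_prodS mxE (bigD1 k) //= => Pik Bkj.
rewrite ltr_pwDl ?mulr_gt0 // sumr_ge0 // => l _.
by rewrite mulr_ge0 // backward_prod_ge0.
Qed.

Hypothesis P_diag : forall t i, 0 < P t i i.

Lemma subset_pos_rows (t : nat) (j : 'I_N) (T T' : nat) :
  (T <= T')%N -> pos_rows t j T \subset pos_rows t j T'.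
Proof.
move=> /subnKC <-; elim: (T' - T)%N => [|n IHn]; first by rewrite addn0.
rewrite addnS (fintype.subset_trans IHn) //; apply/fintype.subsetP => i.
exact/pos_rowsS.
Qed.

Lemma pos_rows_diag (t : nat) (j : 'I_N) (T : nat) : j \in pos_rows t j T.
Proof.
apply: (fintype.subsetP (subset_pos_rows t j (leq0n T))).
by rewrite inE backward_prod0 mxE eqxx ltr01.
Qed.

Variable t0 : nat.
Hypothesis sconn : forall t, strongly_connected (union_edges P t t0).

Lemma pos_rows_grow (t : nat) (j : 'I_N) (T : nat) :
  pos_rows t j T != [set: 'I_N]%SET ->
  pos_rows t j T \proper pos_rows t j (T + t0).
Proof.
rewrite -properT => /properP[_ [x _ xS]].
have [u [v [/= uv uS vS]]] :=
  connect_boundary (sconn (t + T) x j) xS (pos_rows_diag t j T).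
apply/properP; split; first exact/subset_pos_rows/leq_addr.
exists u => //; move: uv; rewrite /union_edges big_geq_mkord.
move=> /bigcupP[s /= ts]; rewrite inE /= => Puv.
(* The edge [(u, v)] is present at some time [s] of the window: [v] stays in the set until [s], [u]
   enters after the factor [P s], and then stays until the window ends. *)
have s_eq : (t + (s - t))%N = s by rewrite subnKC // (leq_trans _ ts) ?leq_addr.
have uS' : u \in pos_rows t j (s - t).+1.
  apply: (@pos_rowsS _ _ _ _ v); first by rewrite s_eq.
  apply: (fintype.subsetP (subset_pos_rows _ _ _)) vS.
  by rewrite -(leq_add2l t) s_eq.
apply: (fintype.subsetP (subset_pos_rows _ _ _)) uS'.
by rewrite -(ltn_add2l t) s_eq addnA.
Qed.

(** Each block of [t0] steps adds at least one row until all [N] are present; the minimum accounts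
    for this saturation. *)
Lemma card_pos_rows (t : nat) (j : 'I_N) (m : nat) :
  (minn m N <= #|pos_rows t j (m * t0)|)%N.
Proof.
elim: m => [|m IHm]; first by rewrite min0n.
rewrite mulSn addnC.
have [full|nfull] := eqVneq (pos_rows t j (m * t0)) [set: 'I_N]%SET.
  have := subset_leq_card (subset_pos_rows t j (leq_addr t0 (m * t0))).
  by rewrite full cardsT card_ord; apply/leq_trans/geq_minr.
apply: leq_trans (proper_card (pos_rows_grow nfull)).
apply: leq_trans (IHm : (_ < _.+1)%N).
by rewrite -minnSS leq_min geq_minl /= (leq_trans (geq_minr _ _)).
Qed.

Lemma backward_prod_gt0 (t T : nat) :
  (N * t0 <= T)%N -> mx_gt0 (backward_prod P t T).
Proof.
move=> leT i j.
have full : pos_rows t j (N * t0) = [set: 'I_N]%SET.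
  apply/eqP; rewrite eqEcard finset.subsetT cardsT card_ord.
  by rewrite -{1}[N]minnn card_pos_rows.
have : i \in pos_rows t j T.
  by apply: (fintype.subsetP (subset_pos_rows t j leT)); rewrite full inE.
by rewrite inE.
Qed.

End BackwardProd.

Theorem proposition4p5 (R : realType) (N : nat) (P : nat -> 'M[R]_N)
  (hP : forall t, row_stochastic (P t))
  (hdiag : forall t i, 0 < P t i i)
  (hpplus : (0 < p_plus P)%E)
  (hG : exists t0 : nat, forall t, strongly_connected (union_edges P t t0)) :
  (0 < p_plus P)%E /\
  exists T : nat, (0 < T)%N /\ forall t, mx_gt0 (backward_prod P t T).
Proof.
(* The successor keeps [T] positive even if [N * t0] is zero, as may happen for [N <= 1]. *)
split=> //; have [t0 sconn] := hG; exists (N * t0).+1%N; split=> // t.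
have P_ge0 s i j : 0 <= P s i j by have [] := hP s.
exact: (backward_prod_gt0 P_ge0 hdiag sconn _ (leqnSn _)).
Qed.
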